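(* Let $p$ be one of the power indices $\mathrm{PGI}$, $\mathrm{DP}$, $\mathrm{Nuc}$ (defined on simple games), or $\mathrm{MSRI}$, $\mathrm{AWI}$, $\mathrm{ARI}$ (defined on weighted games). For each $\varepsilon>0$ there exists an integer $N(\varepsilon)$ such that for every game $v$ on $n\ge N(\varepsilon)$ players in the domain of $p$ and every player $1\le i\le n$, either $p_i(v)=1$ or $p_i(v)\le\frac12+\varepsilon$. For $p\in\{\mathrm{PGI},\mathrm{DP},\mathrm{Nuc},\mathrm{MSRI}\}$ one may even take $\varepsilon=0$ and $N=1$.
   Context: A simple game on $N=\{1,\dots,n\}$ is a surjective, monotone map $v\colon 2^N\to\{0,1\}$; weighted if $v(S)=1$ iff $\sum_{j\in S}w_j\ge q$ for some weights $w_j\ge0$ and quota $q>0$ (written $[q;w]$). Minimal winning coalitions, maximal losing coalitions, null players and dictators as usual (dictator: $v(\{i\})=1$ and all others null). $\mathrm{PGI}_i=m_i/\sum_j m_j$ with $m_j$ the number of minimal winning coalitions containing $j$; $\mathrm{DP}_i=d_i/\sum_j d_j$ with $d_j=\sum_{S\ni j\text{ min. winning}}1/|S|$. Nucleolus: with excess $e(S,x)=v(S)-\sum_{j\in S}x_j$ and $E(x)$ the vector of all $2^n$ excesses sorted decreasingly, $\mathrm{Nuc}(v)$ is the lexicographic minimizer of $E(x)$ over $x\in\mathbb{R}^n$ with $\sum_j x_j\le1$. $\mathrm{MSRI}_i(v)$ is the average of $w_i/\sum_j w_j$ over all integer representations $(q;w)$ of $v$ with minimal $\sum_j w_j$. With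 $P^w(v)=\{w\ge0:\sum w_j=1,\ w(S)\ge w(T)\ \forall S\text{ min. winning},T\text{ max. losing}\}$ and $P^r(v)=\{(q,w)\ge0:\sum w_j=1,q\le1,w(S)\ge q\ \forall S\text{ min. winning},w(T)\le q\ \forall T\text{ max. losing}\}$, $\mathrm{AWI}_i(v)$ and $\mathrm{ARI}_i(v)$ are the averages of $w_i$ over $P^w(v)$ resp. $P^r(v)$ with respect to Lebesgue measure on their affine hulls. *)

(* Defs.v *)
From HB Require Import structures.
From mathcomp Require Import all_boot all_order all_algebra.
Set Implicit Arguments. Unset Strict Implicit. Unset Printing Implicit Defensive.
Import Order.TTheory GRing.Theory Num.Theory.
Local Open Scope ring_scope.

Definition game (n : nat) := {set 'I_n} -> bool.

Definition simple_game (n : nat) (v : game n) : Prop :=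
  (forall Co Ct : {set 'I_n}, Co \subset Ct -> v Co -> v Ct) /\
  (exists Co, v Co) /\ (exists Co, ~~ v Co).

Definition wsum (R : numDomainType) (n : nat) (w : 'rV[R]_n) (Co : {set 'I_n}) : R :=
  \sum_(j in Co) w 0 j.

Definition weighted_game (R : numDomainType) (n : nat) (v : game n) : Prop :=
  simple_game v /\
  exists (w : 'rV[R]_n) (q : R),
    0 < q /\ (forall j, 0 <= w 0 j) /\ (forall Co, v Co = (q <= wsum w Co)).

Definition minimal_winning (n : nat) (v : game n) (Co : {set 'I_n}) : bool :=
  v Co && [forall j in Co, ~~ v (Co :\ j)].

Definition maximal_losing (n : nat) (v : game n) (Ct : {set 'I_n}) : bool :=
  ~~ v Ct && [forall j in ~: Ct, v (j |: Ct)].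

Definition mwc_count (n : nat) (v : game n) (j : 'I_n) : nat :=
  #|[set Co | minimal_winning v Co & j \in Co]|.

Definition PGI (R : numFieldType) (n : nat) (v : game n) (i : 'I_n) : R :=
  (mwc_count v i)%:R / (\sum_(j < n) mwc_count v j)%:R.

Definition dp_weight (R : numFieldType) (n : nat) (v : game n) (j : 'I_n) : R :=
  \sum_(Co : {set 'I_n} | minimal_winning v Co && (j \in Co)) (#|Co|%:R)^-1.

Definition DP (R : numFieldType) (n : nat) (v : game n) (i : 'I_n) : R :=
  dp_weight R v i / \sum_(j < n) dp_weight R v j.

Definition excess (R : numDomainType) (n : nat) (v : game n) (x : 'rV[R]_n)
  (Co : {set 'I_n}) : R := (v Co)%:R - wsum x Co.

Definition excess_vec (R : numDomainType) (n : nat) (v : game n) (x : 'rV[R]_n)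
  : seq R := sort (fun a b : R => b <= a) [seq excess v x Co | Co : {set 'I_n}].

Fixpoint lexle (R : numDomainType) (s t : seq R) : bool :=
  match s, t with
  | a :: s', b :: t' => (a < b) || ((a == b) && lexle s' t')
  | _, _ => true
  end.

Definition is_nucleolus (R : numDomainType) (n : nat) (v : game n) (x : 'rV[R]_n)
  : Prop :=
  wsum x setT <= 1 /\
  forall y : 'rV[R]_n, wsum y setT <= 1 -> lexle (excess_vec v x) (excess_vec v y).

Definition int_rep (n : nat) (v : game n) (q : nat) (w : 'I_n -> nat) : bool :=
  (0 < q)%N && [forall Co : {set 'I_n}, v Co == (q <= \sum_(j in Co) w j)%N].

(* all integer representations with weight sum s (necessarily q <= s and
   w_j <= s since the grand coalition is winning) *)
Definition reps_of_sum (n : nat) (v : game n) (s : nat)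
  : {set 'I_s.+1 * {ffun 'I_n -> 'I_s.+1}} :=
  [set qw : 'I_s.+1 * {ffun 'I_n -> 'I_s.+1} | int_rep v qw.1 (fun j => qw.2 j) & (\sum_(j < n) qw.2 j == s)%N].

Definition is_MSRI (R : numFieldType) (n : nat) (v : game n) (p : 'rV[R]_n) : Prop :=
  exists s : nat,
    reps_of_sum v s != set0 /\
    (forall s', (s' < s)%N -> reps_of_sum v s' = set0) /\
    forall i : 'I_n,
      p 0 i = (#|reps_of_sum v s|%:R)^-1 *
              \sum_(qw in reps_of_sum v s) ((qw.2 i : nat)%:R / s%:R).

(* grid point z/m in R^d, z in Z^d with |z_l| <= B m *)
Definition grid_pt (R : numFieldType) (d B m : nat)
  (z : {ffun 'I_d -> 'I_(2 * B * m).+1}) : 'rV[R]_d :=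
  \row_l (((z l : nat)%:R - (B * m)%:R) / m%:R).

(* c is the average (centroid) of P w.r.t. Lebesgue measure on aff(P):
   there is an injective affine parametrisation phi : R^d -> R^k whose image
   contains P and such that phi^-1(P) contains a d-dimensional box (so the
   image of phi is aff(P)), phi^-1(P) is contained in [-B,B]^d, and the
   Riemann-grid averages of phi over phi^-1(P) converge to c. *)
Definition is_centroid (R : numFieldType) (k : nat) (P : pred 'rV[R]_k)
  (c : 'rV[R]_k) : Prop :=
  exists (d : nat) (a : 'rV[R]_k) (A : 'M[R]_(d, k)) (B : nat),
    [/\ row_free A,
        (forall x, P x -> exists y : 'rV[R]_d, x = a + y *m A),
        (exists (y0 : 'rV[R]_d) (r : R), 0 < r /\
           forall y : 'rV[R]_d, (forall l, `|y 0 l - y0 0 l| <= r) -> P (a + y *m A)),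
        (forall y : 'rV[R]_d, P (a + y *m A) -> forall l, `|y 0 l| <= B%:R) &
        forall eps : R, 0 < eps -> exists M : nat, forall m : nat, (M <= m)%N ->
          forall i : 'I_k,
            `| (\sum_(z : {ffun 'I_d -> 'I_(2 * B * m).+1} | P (a + grid_pt R z *m A))
                   (a + grid_pt R z *m A) 0 i)
               / (#|[set z : {ffun 'I_d -> 'I_(2 * B * m).+1} |
                       P (a + grid_pt R z *m A)]|)%:R
               - c 0 i | < eps ].

Definition Pw (R : numDomainType) (n : nat) (v : game n) : pred 'rV[R]_n :=
  fun w => [&& [forall j, 0 <= w 0 j], wsum w setT == 1 &
             [forall Co, [forall Ct, (minimal_winning v Co && maximal_losing v Ct) ==>
                                     (wsum w Ct <= wsum w Co)]]].

(* P^r(v): points (q, w) encoded in 'rV_(n.+1): coordinate ord0 is q,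
   coordinate (lift ord0 j) is w_j *)
Definition rep_w (R : numDomainType) (n : nat) (x : 'rV[R]_n.+1) : 'rV[R]_n :=
  \row_j x 0 (lift ord0 j).

Definition Pr (R : numDomainType) (n : nat) (v : game n) : pred 'rV[R]_n.+1 :=
  fun x => [&& [forall k, 0 <= x 0 k], wsum (rep_w x) setT == 1, x 0 ord0 <= 1,
             [forall Co, minimal_winning v Co ==> (x 0 ord0 <= wsum (rep_w x) Co)] &
             [forall Ct, maximal_losing v Ct ==> (wsum (rep_w x) Ct <= x 0 ord0)]].

(* AWI_i(v) = c 0 i ; ARI_i(v) = c 0 (lift ord0 i) *)
Definition is_AWI (R : numFieldType) (n : nat) (v : game n) (c : 'rV[R]_n) : Prop :=
  is_centroid (@Pw R n v) c.

Definition is_ARI (R : numFieldType) (n : nat) (v : game n) (c : 'rV[R]_n.+1) : Prop :=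
  is_centroid (@Pr R n v) c.

(* Main.v *)
Require Import Defs.
From HB Require Import structures.
From mathcomp Require Import all_boot all_order all_algebra.
From mathcomp Require Import ring lra zify.
Set Implicit Arguments. Unset Strict Implicit. Unset Printing Implicit Defensive.
Import Order.TTheory GRing.Theory Num.Theory.
Local Open Scope ring_scope.

(* PGI and DP are double counts over minimal winning coalitions S, each contributing at
   least as much to the players other than i as to i unless S = {i}. A nucleolus giving i
   more than 1/2 lies in the core, where i and any second veto player would be
   interchangeable. In a minimal integer representation giving i more than half of the
   weight, w_i (and q, when {i} loses) could be decreased by 1 unless i is a dictator.

   For AWI and ARI, let P be the polytope and H the part of P where
   w_i > 1/2 + eps/2. A homothety of ratio lam > 1 depending only on eps, centred at the
   vertex e_i of P (for ARI at (0, e_i) or (1, e_i), according to the side of 1/2 on which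
   the quota lies), maps H into P. Since dim P >= n - 1, the part H has at most about
   lam^(1-n) of the volume of P, so it raises the average of w_i above 1/2 + eps/2 only
   by o(1). The volume comparison is carried out directly on the grid points. *)

(** * Minimal winning coalitions, PGI and DP *)

Lemma simple_game_set0 n (v : game n) : simple_game v -> ~~ v set0.
Proof.
move=> [mono [_ [Co lCo]]]; apply: contra lCo; exact: mono (sub0set _).
Qed.

Lemma simple_game_setT n (v : game n) : simple_game v -> v setT.
Proof. by move=> [mono [[Co wCo] _]]; apply: mono wCo; rewrite subsetT. Qed.

Lemma minimal_winning_exists n (v : game n) (Co : {set 'I_n}) :
  v Co -> exists2 Cs : {set 'I_n}, Cs \subset Co & minimal_winning v Cs.
Proof.
move=> /minset_exists[Cs /minsetP[wCs minCs] sCs]; exists Cs => //.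
rewrite /minimal_winning wCs; apply/forall_inP => j jCs; apply/negP => wD.
by have := minCs _ wD (subD1set _ _); move/setP/(_ j); rewrite !inE eqxx jCs.
Qed.

Lemma maximal_losing_exists n (v : game n) (Co : {set 'I_n}) :
  ~~ v Co -> exists2 Ct : {set 'I_n}, Co \subset Ct & maximal_losing v Ct.
Proof.
move=> lCo; have [Ct /maxsetP[lCt maxCt] sCt] :=
  @maxset_exists _ (fun C => ~~ v C) _ lCo.
exists Ct => //; rewrite /maximal_losing lCt; apply/forall_inP => j.
rewrite inE => jCt; apply/negPn/negP => lU.
by have := maxCt _ lU (subsetUr _ _); move/setP/(_ j); rewrite !inE eqxx (negbTE jCt).
Qed.

Lemma minimal_winning_sub n (v : game n) (Co Ct : {set 'I_n}) :
  simple_game v -> minimal_winning v Co -> Ct \subset Co -> v Ct -> Ct = Co.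
Proof.
move=> [mono _] /andP[_ /forall_inP minCo] sub wCt.
apply/eqP; rewrite eqEsubset sub; apply/subsetP => j jCo.
apply: contraTT wCt => jCt; apply: contra (minCo _ jCo).
by apply: mono; rewrite subsetD1 sub.
Qed.

Lemma minimal_winning_neq0 n (v : game n) (Co : {set 'I_n}) :
  simple_game v -> minimal_winning v Co -> Co != set0.
Proof.
move=> /simple_game_set0 l0 /andP[wCo _].
by apply: contraNneq l0 => <-.
Qed.

(** * Shares in weighted counts of minimal winning coalitions *)

Section Share.
Variables (R : realFieldType) (n : nat) (v : game n) (g : {set 'I_n} -> R).
Hypothesis sv : simple_game v.
Hypothesis g_ge0 : forall Co, 0 <= g Co.
Hypothesis g_le1 : forall Co, Co != set0 -> g Co <= 1.
Hypothesis g_ge1 : forall Co, Co != set0 -> 1 <= #|Co|%:R * g Co.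

Let f j := \sum_(Co : {set 'I_n} | minimal_winning v Co && (j \in Co)) g Co.

Lemma share_total :
  \sum_j f j = \sum_(Co | minimal_winning v Co) #|Co|%:R * g Co.
Proof.
rewrite /f; under eq_bigr do rewrite big_mkcondr.
rewrite exchange_big; apply: eq_bigr => Co _.
by rewrite -big_mkcond sumr_const mulr_natl.
Qed.

(** If [{i}] loses, every minimal winning coalition through [i] has at least two members and counts
    at least twice in the total. If [{i}] wins, it is the only one through [i], and any other one
    adds at least 1 >= [g [set i]]. *)
Lemma share_eq1_or_le_half i : f i / \sum_j f j = 1 \/ f i / \sum_j f j <= 2^-1.
Proof.
have half : 2 * f i <= \sum_j f j -> f i / \sum_j f j <= 2^-1.
  (* A zero total gives the quotient 0 by convention. *)
  move=> le2; have [t0|t0] := eqVneq (\sum_j f j) 0.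
    by rewrite t0 invr0 mulr0 invr_ge0.
  have tp : 0 < \sum_j f j.
    by rewrite lt_def t0 /=; apply: sumr_ge0 => j _; apply: sumr_ge0.
  by rewrite ler_pdivrMr// -ler_pdivrMl ?invr_gt0// invrK.
have [wi|li] := boolP (v [set i]); last first.
  right; apply: half; rewrite share_total mulr_sumr big_mkcondr /=.
  apply: ler_sum => Co mCo; case: ifP => iCo; last by rewrite mulr_ge0.
  apply: ler_wpM2r => //; rewrite ler_nat.
  rewrite (cardsD1 i) iCo ltnS card_gt0; apply: contraNneq li => D0.
  by rewrite -(_ : Co = [set i]) ?(andP mCo).1// -(setD1K iCo) D0 setU0.
have mi : minimal_winning v [set i].
  rewrite /minimal_winning wi; apply/forall_inP => j; rewrite inE => /eqP->.
  by rewrite setDv simple_game_set0.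
have fiE : f i = g [set i].
  rewrite /f (big_pred1 [set i])// => Co; apply/andP/eqP => [[mCo iCo]|->].
    by rewrite -(minimal_winning_sub sv mCo _ wi) ?sub1set.
  by rewrite mi set11.
have i0 : [set i] != set0 by apply/set0Pn; exists i; rewrite set11.
have := share_total; rewrite (bigD1 [set i])//= cards1 mul1r => tE.
have [/existsP[Co /andP[mCo nCo]]|none] :=
  boolP [exists Co, minimal_winning v Co && (Co != [set i])].
  right; apply: half; rewrite tE (bigD1 Co) ?mCo//= addrA.
  have := g_ge1 (minimal_winning_neq0 sv mCo); have := g_le1 i0; rewrite fiE.
  have : 0 <= \sum_(Ct | minimal_winning v Ct && (Ct != [set i]) && (Ct != Co))
     #|Ct|%:R * g Ct by apply: sumr_ge0 => ? _; rewrite mulr_ge0.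
  lra.
left; rewrite tE big_pred0 ?addr0 ?fiE; last first.
  by move=> Co; move/existsPn: none => /(_ Co)/negbTE.
by apply: divff; rewrite gt_eqF//; have := g_ge1 i0; rewrite cards1; lra.
Qed.

End Share.

Lemma PGI_eq1_or_le_half (R : realFieldType) n (v : game n) i :
  simple_game v -> PGI R v i = 1 \/ PGI R v i <= 2^-1.
Proof.
move=> sv; have mE j : (mwc_count v j)%:R =
    \sum_(Co : {set 'I_n} | minimal_winning v Co && (j \in Co)) 1 :> R.
  rewrite /mwc_count -sum1_card natr_sum; apply: eq_bigl => Co.
  by rewrite inE.
rewrite /PGI natr_sum mE; under eq_bigr do rewrite mE.
apply: (@share_eq1_or_le_half _ _ _ (fun=> 1)) => // Co.
by rewrite -card_gt0 mulr1 ler1n.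
Qed.

Lemma DP_eq1_or_le_half (R : realFieldType) n (v : game n) i :
  simple_game v -> DP R v i = 1 \/ DP R v i <= 2^-1.
Proof.
move=> sv; apply: (@share_eq1_or_le_half _ _ _ (fun Co => (#|Co|%:R)^-1)) => // Co.
- by rewrite invr_ge0.
- by rewrite -card_gt0 => c0; rewrite invf_le1 ?ltr0n// ler1n.
- by rewrite -card_gt0 => c0; rewrite divff// pnatr_eq0 -lt0n.
Qed.

(** * The nucleolus *)

Lemma subset_setC1 (T : finType) (A : {set T}) i : i \notin A -> A \subset [set~ i].
Proof.
by move=> iA; apply/subsetP => k kA; rewrite !inE; apply: contraNneq iA => <-.
Qed.

Section WeightSums.
Variables (R : numDomainType) (n : nat).
Implicit Types (x y : 'rV[R]_n) (Co : {set 'I_n}).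

Lemma wsumD x y Co : wsum (x + y) Co = wsum x Co + wsum y Co.
Proof. by rewrite -big_split; apply: eq_bigr => j _; rewrite mxE. Qed.

Lemma wsumZ t x Co : wsum (t *: x) Co = t * wsum x Co.
Proof. by rewrite mulr_sumr; apply: eq_bigr => j _; rewrite mxE. Qed.

Lemma wsumB x y Co : wsum (x - y) Co = wsum x Co - wsum y Co.
Proof. by rewrite wsumD -scaleN1r wsumZ mulN1r. Qed.

Lemma wsum_const (a : R) Co : wsum (const_mx a : 'rV[R]_n) Co = #|Co|%:R * a.
Proof.
by rewrite /wsum (eq_bigr (fun=> a)) => [|j _]; rewrite ?sumr_const ?mulr_natl// mxE.
Qed.

Lemma wsum_delta i Co : wsum (delta_mx 0 i : 'rV[R]_n) Co = (i \in Co)%:R.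
Proof.
rewrite /wsum big_mkcond (bigD1 i)//= big1 ?addr0 => [|j ji].
  by rewrite mxE !eqxx; case: ifP.
by rewrite mxE (negbTE ji) andbF if_same.
Qed.

Lemma wsumT x : wsum x setT = \sum_j x 0 j.
Proof. by apply: eq_bigl => j; rewrite inE. Qed.

Lemma wsum0 x : wsum x set0 = 0.
Proof. by rewrite /wsum big_set0. Qed.

Lemma wsum1 x i : wsum x [set i] = x 0 i.
Proof. by rewrite /wsum big_set1. Qed.

Lemma wsum_setC x Co : wsum x (~: Co) = wsum x setT - wsum x Co.
Proof.
rewrite wsumT (bigID (mem Co)) /= -/(wsum x Co) addrC addrK; apply: eq_bigl => j.
by rewrite !inE.
Qed.

Lemma wsum_ge0 x Co : (forall j, 0 <= x 0 j) -> 0 <= wsum x Co.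
Proof. by move=> x0; apply: sumr_ge0. Qed.

Lemma wsum_ge1 x Co i : (forall j, 0 <= x 0 j) -> i \in Co -> x 0 i <= wsum x Co.
Proof. by move=> x0 iCo; rewrite /wsum (bigD1 i)//= lerDl sumr_ge0. Qed.

Lemma le_wsumT x Co : (forall j, 0 <= x 0 j) -> wsum x Co <= wsum x setT.
Proof. by move=> x0; rewrite -subr_ge0 -wsum_setC wsum_ge0. Qed.

Lemma wsum_notin x Co i : (forall j, 0 <= x 0 j) -> i \notin Co ->
  wsum x Co <= wsum x setT - x 0 i.
Proof.
move=> x0 iCo; rewrite lerBrDr -lerBrDl -wsum_setC.
by apply: wsum_ge1; rewrite ?inE.
Qed.

End WeightSums.

(** * Lexicographic comparison of sorted vectors *)

Section Lexicographic.
Variable R : realDomainType.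
Implicit Types s u : seq R.

(* For decreasingly sorted sequences, the first difference shows up as the largest
   threshold at which the counting functions differ. *)
Lemma lexle_count s u : size s = size u ->
  sorted (fun a b => b <= a) s -> sorted (fun a b => b <= a) u -> lexle s u ->
  s = u \/ exists t, (count (>= t) s < count (>= t) u)%N /\
                     forall r, t < r -> count (>= r) s = count (>= r) u.
Proof.
have tr : transitive (fun a b : R => b <= a) by move=> ? ? ? h1 h2; exact: le_trans h2 h1.
elim: s u => [|a s IH] [|b u]//=; first by left.
move=> [/IH{}IH] srt_s srt_u.
have all_s := order_path_min tr srt_s; have all_u := order_path_min tr srt_u.
case: ltgtP => //= [ab _|ab lesu]; last first.
  subst b; case: (IH (path_sorted srt_s) (path_sorted srt_u) lesu) => [->|[t [lt eqr]]].
    by left.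
  right; exists t; split; first by rewrite ltn_add2l.
  by move=> r /eqr->.
have cnt0 r c l : all (fun y => y <= c) l -> c < r -> count (>= r) (c :: l) = 0%N.
  move=> /allP lec cr; apply/eqP; rewrite -leqn0 leqNgt -has_count.
  apply/hasPn => y; rewrite inE => /orP[/eqP->|/lec yc] /=; first by rewrite lt_geF.
  by rewrite lt_geF// (le_lt_trans yc).
right; exists b; split.
  by rewrite -[X in (X < _)%N]/(count _ (a :: s)) cnt0// lexx.
move=> r br; rewrite -[LHS]/(count _ (a :: s)) -[RHS]/(count _ (b :: u)).
by rewrite !cnt0// (lt_trans ab).
Qed.

(** For r >= [f t0], the points where [g] reaches r are among those where [f] does, properly so at r
    = [f t0]. Hence the threshold given by [lexle_count] can lie neither at or above [f t0] nor
    below it. *)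
Lemma lexle_sort_improve (T : finType) (f g : T -> R) (t0 : T) :
  g t0 < f t0 -> (forall t, g t < f t0 \/ g t = f t) ->
  ~~ lexle (sort (fun a b => b <= a) [seq f t | t : T])
           (sort (fun a b => b <= a) [seq g t | t : T]).
Proof.
move=> lt0 dom; apply/negP => lefg.
have tot : total (fun a b : R => b <= a) by move=> a b; exact: le_total.
have cntE (h : T -> R) r : count (>= r) (sort (fun a b => b <= a) [seq h t | t : T]) =
    #|[set t | r <= h t]|.
  rewrite count_sort count_map -sum1_count big_enum_cond -sum1_card.
  by apply: eq_bigl => t; rewrite !inE.
have cnt_ge r : f t0 <= r ->
    [set t | r <= g t] \subset [set t | r <= f t].
  move=> tr; apply/subsetP => t; rewrite !inE.
  case: (dom t) => [gt rg|->//]; move: (le_lt_trans (le_trans tr rg) gt).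
  by rewrite ltxx.
have cnt_lt : (#|[set t | (f t0 <= g t)%R]| < #|[set t | (f t0 <= f t)%R]|)%N.
  apply: proper_card; rewrite properE cnt_ge//=; apply/subsetPn; exists t0.
    by rewrite inE.
  by rewrite inE -ltNge.
have := lexle_count _ (sort_sorted tot _) (sort_sorted tot _) lefg.
rewrite !size_sort !size_map => /(_ erefl) [eqfg|[t []]].
  by move: cnt_lt; rewrite -!cntE eqfg ltnn.
rewrite !cntE => cnt_t eqr; have [tf|ft] := ltP t (f t0).
  by move: (eqr _ tf) cnt_lt; rewrite !cntE => ->; rewrite ltnn.
by move: cnt_t; rewrite ltnNge subset_leq_card// cnt_ge.
Qed.

End Lexicographic.

(** Halving the minimum makes the bound strict; the default 1 covers an empty [P]. *)
Lemma pos_lower_bound (R : realFieldType) (T : finType) (P : pred T) (h : T -> R) :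
  (forall t, P t -> 0 < h t) -> exists2 e : R, 0 < e & forall t, P t -> e < h t.
Proof.
move=> h0; exists (\big[Num.min/1]_(t | P t) h t / 2).
  by rewrite divr_gt0//; elim/big_ind: _ => // x y x0 y0; rewrite lt_min x0.
move=> t Pt; have : \big[Num.min/1]_(t | P t) h t <= h t by exact: bigmin_le_cond.
by have := h0 _ Pt; lra.
Qed.

(** * Efficiency, non-negativity and core membership of the nucleolus *)

Section Nucleolus.
Variables (R : realFieldType) (n : nat) (v : game n) (x : 'rV[R]_n).
Hypotheses (sv : simple_game v) (nuc : is_nucleolus v x).

Lemma nucleolus_sum_le1 : wsum x setT <= 1. Proof. exact: nuc.1. Qed.

(** The form in which optimality of [x] is used from here on, with [S0] as pivot. *)
Lemma nucleolus_not_improvable (y : 'rV[R]_n) S0 : wsum y setT <= 1 ->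
  excess v y S0 < excess v x S0 ->
  ~ (forall Co, excess v y Co < excess v x S0 \/ excess v y Co = excess v x Co).
Proof.
move=> /nuc.2 lexy lt0 dom; move/negP: (lexle_sort_improve lt0 dom); exact.
Qed.

Lemma excess_shift (d : R) (u : 'rV[R]_n) Co :
  excess v (x + d *: u) Co = excess v x Co - d * wsum u Co.
Proof. by rewrite /excess wsumD wsumZ opprD addrA. Qed.

(* Moving in a direction that lowers every coalition of maximal excess would lower
   the maximal excess itself. *)
Lemma nucleolus_max_excess (u : 'rV[R]_n) : wsum u setT <= 0 ->
  exists2 Co, wsum u Co <= 0 & forall Ct, excess v x Ct <= excess v x Co.
Proof.
move=> u0; have [S0 _ maxS0] := @arg_maxP _ _ _ set0 xpredT (excess v x) isT.
have [/existsP[Co /andP[uCo /eqP eCo]]|/existsPn none] :=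
    boolP [exists Co, (wsum u Co <= 0) && (excess v x Co == excess v x S0)].
  by exists Co => // Ct; rewrite eCo; exact: maxS0.
have upos Co : excess v x Co = excess v x S0 -> 0 < wsum u Co.
  by move=> /eqP eCo; have := none Co; rewrite eCo andbT ltNge.
pose P Co := excess v x Co < excess v x S0.
(* A step this small cannot lift a coalition of smaller excess up to the maximum; the added 1 keeps
   the denominator positive. *)
have [d d0 dP] : exists2 d : R, 0 < d &
    forall Co, P Co -> d < (excess v x S0 - excess v x Co) / (1 + `|wsum u Co|).
  apply: pos_lower_bound => Co PCo.
  by rewrite divr_gt0 ?subr_gt0// ltr_pwDl.
exfalso; apply: (@nucleolus_not_improvable (x + d *: u) S0).
- rewrite wsumD wsumZ; suff : d * wsum u setT <= 0 by have := nucleolus_sum_le1; lra.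
  by rewrite mulr_ge0_le0// ltW.
- rewrite excess_shift; suff : 0 < d * wsum u S0 by lra.
  by rewrite mulr_gt0// upos.
move=> Co; left; rewrite excess_shift.
have := maxS0 Co isT; rewrite /= le_eqVlt => /orP[/eqP eCo|PCo].
  rewrite eCo; suff : 0 < d * wsum u Co by lra.
  by rewrite mulr_gt0// upos.
have := dP _ PCo; rewrite ltr_pdivlMr; last by rewrite ltr_pwDl.
have : d * - wsum u Co <= d * `|wsum u Co| by rewrite ler_pM2l// ler_normr lexx orbT.
by lra.
Qed.

Lemma nucleolus_sum (i : 'I_n) : wsum x setT = 1.
Proof.
apply/eqP; rewrite eq_le nucleolus_sum_le1 leNgt; apply/negP => lt1.
have n0 : (0 < n)%N by rewrite (leq_trans _ (ltn_ord i)).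
pose d := (1 - wsum x setT) / n%:R.
have d0 : 0 < d by rewrite divr_gt0 ?subr_gt0 ?ltr0n.
have i0 : [set i] != set0 by apply/set0Pn; exists i; rewrite set11.
have [S0 S00 maxS0] := @arg_maxP _ _ _ [set i] (fun Co => Co != set0) (excess v x) i0.
have dec Co : Co != set0 -> excess v (x + d *: const_mx 1) Co < excess v x Co.
  move=> Co0; rewrite excess_shift wsum_const mulr1 ltrBlDr ltrDl mulr_gt0// ltr0n.
  by rewrite card_gt0.
apply: (@nucleolus_not_improvable (x + d *: const_mx 1) S0).
- by rewrite wsumD wsumZ wsum_const mulr1 cardsT card_ord /d divfK ?gt_eqF ?ltr0n// subrKC.
- exact: dec.
move=> Co; have [->|Co0] := eqVneq Co set0.
  by right; rewrite excess_shift wsum0 mulr0 subr0.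
left; apply: lt_le_trans (dec _ Co0) _; exact: maxS0.
Qed.

(** Suppose x_j < 0. The direction n e_j - 1 has sum 0, hence is non-positive on some [Co] of
    maximal excess. Adding [j] to a coalition raises its excess, so [j] is in [Co], and n - |Co| <=
    0 makes [Co] the grand coalition. Its excess is 0, less than that of [{j}]. *)
Lemma nucleolus_ge0 j : 0 <= x 0 j.
Proof.
rewrite leNgt; apply/negP => xj; have [mono _] := sv.
have vT := simple_game_setT sv.
have sum1 := nucleolus_sum j.
have n1 : (1 < n)%N.
  rewrite ltnNge; apply/negP => n1; move: sum1.
  rewrite (_ : setT = [set j]) ?wsum1; first by lra.
  apply/setP => k; rewrite !inE; apply/esym/eqP/val_inj => /=.
  by have := ltn_ord j; have := ltn_ord k; lia.
have [Co uCo maxCo] := @nucleolus_max_excess (n%:R *: delta_mx 0 j - const_mx 1)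
  ltac:(by rewrite wsumB wsumZ wsum_delta wsum_const inE cardsT card_ord subrr).
have jCo : j \in Co.
  apply: contraTT (maxCo (j |: Co)) => jCo.
  rewrite -ltNge /excess /wsum big_setU1//= -/(wsum x Co).
  have : (v Co)%:R <= (v (j |: Co))%:R :> R.
    by rewrite ler_nat; case: (boolP (v Co)) => // /(mono _ _ (subsetUr [set j] Co))->.
  by lra.
have CoT : Co = setT.
  apply/eqP; rewrite eqEcard subsetT cardsT card_ord -(ler_nat R).
  by move: uCo; rewrite wsumB wsumZ wsum_delta wsum_const jCo !mulr1 subr_le0.
have := maxCo [set j]; rewrite CoT /excess wsum1 sum1 vT /=.
have : 0 <= (v [set j])%:R :> R by rewrite ler0n.
by lra.
Qed.

(** The direction 1 - n e_i gives a coalition of maximal excess that contains [i] or is empty, so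
    this excess is at most max(1 - x_i, 0) < 1/2. If [[set~ i]] won, its excess would be x_i >
    1/2. *)
Lemma nucleolus_veto i : 2^-1 < x 0 i -> ~~ v [set~ i].
Proof.
move=> xi; apply/negP => wC; have sum1 := nucleolus_sum i.
have x0 := nucleolus_ge0.
have [Co uCo maxCo] := @nucleolus_max_excess (const_mx 1 - n%:R *: delta_mx 0 i)
  ltac:(by rewrite wsumB wsumZ wsum_delta wsum_const inE cardsT card_ord mulr1 subrr).
have := maxCo [set~ i]; rewrite {1}/excess wC wsum_setC sum1 wsum1 /=.
have v1 : (v Co)%:R <= 1 :> R by rewrite (ler_nat _ _ 1) leq_b1.
have [iCo|iCo] := boolP (i \in Co).
  by have := wsum_ge1 x0 iCo; rewrite /excess; lra.
move: uCo; rewrite wsumB wsumZ wsum_delta wsum_const (negbTE iCo).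
rewrite mulr1 mulr0 subr0 lern0 cards_eq0 => /eqP->.
by rewrite /excess wsum0 (negbTE (simple_game_set0 sv)) /= mulr0n; lra.
Qed.

(** When [i] is a veto player, giving everything to [i] makes all excesses non-positive, so a
    positive maximal excess of [x] could be improved. *)
Lemma nucleolus_in_core i : ~~ v [set~ i] -> forall Co, v Co -> 1 <= wsum x Co.
Proof.
move=> nC Co vCo; have [mono _] := sv; rewrite leNgt; apply/negP => lt1.
have iin Ct : v Ct -> i \in Ct.
  by apply: contraTT => iCt; apply: contra nC; apply: mono; exact: subset_setC1.
have [S0 _ maxS0] := @arg_maxP _ _ _ set0 xpredT (excess v x) isT.
have pos : 0 < excess v x S0.
  by apply: lt_le_trans (maxS0 Co isT); rewrite /excess vCo subr_gt0.
have ei Ct : excess v (delta_mx 0 i : 'rV[R]_n) Ct <= 0.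
  rewrite /excess wsum_delta; case: (boolP (v Ct)) => [/iin->|_]; first by rewrite subrr.
  by rewrite sub0r oppr_le0 ler0n.
apply: (@nucleolus_not_improvable (delta_mx 0 i) S0).
- by rewrite wsum_delta inE.
- exact: le_lt_trans (ei _) pos.
by move=> Ct; left; exact: le_lt_trans (ei _) pos.
Qed.

(** Every [j] other than [i] gets 0: if [[set~ j]] wins, the core condition 1 <= 1 - x_j forces it;
    if [j] is a veto player, symmetry with [i] contradicts optimality. *)
Lemma nucleolus_eq1_or_le_half i : x 0 i = 1 \/ x 0 i <= 2^-1.
Proof.
have [|xi] := leP (x 0 i) 2^-1; [by right|left].
have sum1 := nucleolus_sum i; have x0 := nucleolus_ge0.
have vetoi := nucleolus_veto xi; have core := nucleolus_in_core vetoi.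
have xC0 (j : 'I_n) : j != i -> x 0 j = 0.
  move=> ji; have xij : x 0 j <= 1 - x 0 i.
    by rewrite -sum1; apply: le_trans (wsum_notin x0 (_ : i \notin [set j]));
       rewrite ?wsum1// inE eq_sym.
  have [wC|vetoj] := boolP (v [set~ j]).
    have := core _ wC; rewrite wsum_setC sum1 wsum1; have := x0 j; lra.
  (* i and j are both veto players, hence interchangeable: moving weight from i to j
     lowers the larger excess of every pair of swapped coalitions. *)
  have losing (Co : {set 'I_n}) : (i \notin Co) || (j \notin Co) -> ~~ v Co.
    by move=> /orP[] h; [apply: contra vetoi|apply: contra vetoj];
       apply: sv.1; exact: subset_setC1.
  (* This [d] equalises the two payoffs. The pivot [{j}] has excess -x_j, above the new excess of
     every coalition with exactly one of [i], [j]. *)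
  exfalso; pose d := (x 0 i - x 0 j) / 2.
  have d0 : 0 < d by rewrite /d; lra.
  apply: (@nucleolus_not_improvable (x + d *: (delta_mx 0 j - delta_mx 0 i)) [set j]).
  - by rewrite wsumD wsumZ wsumB !wsum_delta !inE sum1 subrr mulr0 addr0.
  - rewrite excess_shift wsumB !wsum_delta !inE eqxx eq_sym (negbTE ji) /= mulr0n; lra.
  move=> Co; rewrite excess_shift wsumB !wsum_delta.
  case: (boolP (i \in Co)) => iCo; case: (boolP (j \in Co)) => jCo.
  - by right; rewrite subrr mulr0 subr0.
  - left; rewrite /excess (negbTE (losing _ _)) ?jCo ?orbT//.
    rewrite (negbTE (losing [set j] _)) ?inE ?(eq_sym i) ?ji// wsum1 /= mulr0n.
    by have := wsum_ge1 x0 iCo; rewrite /d; lra.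
  - left; rewrite /excess (negbTE (losing _ _)) ?iCo//.
    rewrite (negbTE (losing [set j] _)) ?inE ?(eq_sym i) ?ji// wsum1 /= mulr0n.
    by have := wsum_ge1 x0 jCo; lra.
  - by right; rewrite subrr mulr0 subr0.
by move: sum1; rewrite wsumT (bigD1 i)//= big1 ?addr0// => j /xC0.
Qed.

End Nucleolus.

(** * Minimal integer representations *)

Lemma int_repP n (v : game n) q w :
  reflect ((0 < q)%N /\ forall Co : {set 'I_n}, v Co = (q <= \sum_(j in Co) w j)%N)
          (int_rep v q w).
Proof.
apply: (iffP andP) => -[q0 rep]; split=> //.
  by move=> Co; apply/eqP; move/forallP: rep.
by apply/forallP => Co; rewrite rep.
Qed.

Lemma reps_of_sum_neq0 n (v : game n) q w : v setT -> int_rep v q w ->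
  reps_of_sum v (\sum_j w j)%N != set0.
Proof.
move=> vT rep; set s := (\sum_j w j)%N; have [q0 repE] := int_repP _ _ _ rep.
have qs : (q < s.+1)%N.
  by move: vT; rewrite repE ltnS (eq_bigl predT)// => j; rewrite inE.
have ws j : (w j < s.+1)%N by rewrite ltnS /s (bigD1 j)//= leq_addr.
apply/set0Pn; exists (Ordinal qs, [ffun j => Ordinal (ws j)]); rewrite inE /=.
apply/andP; split.
  apply/int_repP; split=> // Co; rewrite repE; congr (_ <= _)%N.
  by apply: eq_bigr => j _; rewrite ffunE.
by rewrite /s; apply/eqP/eq_bigr => j _; rewrite ffunE.
Qed.

Section MinimalRepresentation.
Variables (n : nat) (v : game n) (q : nat) (w : 'I_n -> nat).
Hypotheses (vT : v setT) (rep : int_rep v q w).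
Hypothesis minimal : forall s', (s' < \sum_j w j)%N -> reps_of_sum v s' = set0.

Lemma minimal_rep_sum q' w' : int_rep v q' w' -> (\sum_j w j <= \sum_j w' j)%N.
Proof.
move=> rep'; rewrite leqNgt; apply/negP => /minimal/eqP.
by apply/negP; exact: reps_of_sum_neq0 vT rep'.
Qed.

(** Stated additively because subtraction on naturals truncates; 0 < [w i] makes it exact here. *)
Lemma sum_decr1 (P : pred 'I_n) i : (0 < w i)%N ->
  (\sum_(j | P j) (w j - (j == i)) + P i = \sum_(j | P j) w j)%N.
Proof.
move=> wi0; have [Pi|nPi] := boolP (P i); last first.
  rewrite addn0; apply: eq_bigr => j Pj; case: eqP => [ji|]; last by rewrite subn0.
  by rewrite ji (negbTE nPi) in Pj.
rewrite (bigD1 i)//= [RHS](bigD1 i)//= eqxx addnAC subnK//; congr addn.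
by apply: eq_bigr => j /andP[_ /negbTE->]; rewrite subn0.
Qed.

Lemma minimal_rep_majority i : (\sum_j w j < 2 * w i)%N ->
  forall Co : {set 'I_n}, v Co = (i \in Co).
Proof.
move=> maj; have [q0 repE] := int_repP _ _ _ rep.
have wi0 : (0 < w i)%N by lia.
have inS (Co : {set 'I_n}) : i \in Co -> (w i <= \sum_(j in Co) w j)%N.
  by move=> iCo; rewrite (bigD1 i)//= leq_addr.
have notinS (Co : {set 'I_n}) : i \notin Co -> (\sum_(j in Co) w j < w i)%N.
  move=> iCo; suff : (\sum_(j in Co) w j + w i <= \sum_j w j)%N by lia.
  rewrite [X in (_ <= X)%N](bigD1 i)//= addnC leq_add2l.
  rewrite [X in (_ <= X)%N]big_mkcond [X in (X <= _)%N]big_mkcond /=.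
  by apply: leq_sum => j _; case: ifP => // jCo; case: eqP jCo iCo => // ->->.
pose w' j := (w j - (j == i))%N.
have decr (Co : {set 'I_n}) :
    (\sum_(j in Co) w' j + (i \in Co) = \sum_(j in Co) w j)%N.
  exact: (sum_decr1 (fun j => j \in Co) wi0).
have sum' : (\sum_j w' j < \sum_j w j)%N.
  by rewrite -(sum_decr1 xpredT wi0) addn1.
have noqw q' : ~~ int_rep v q' w'.
  by apply/negP => /minimal_rep_sum; rewrite leqNgt sum'.
(* If w_i < q, lower both by 1: coalitions with [i] keep their margin, the others weigh less than
   w_i <= q - 1 and still lose. *)
have [wiq|qwi] := ltnP (w i) q.
  case/negP: (noqw q.-1); apply/int_repP; split; first lia.
  move=> Co; rewrite repE; have := decr Co.
  by case: (boolP (i \in Co)) => [_ /=|/notinS] /=; lia.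
(* If q < w_i, lower w_i alone: [i] still reaches the quota by itself. *)
have wiE : w i = q.
  apply/eqP; rewrite eqn_leq qwi andbT leqNgt; apply/negP => qltw.
  case/negP: (noqw q); apply/int_repP; split=> // Co.
  rewrite repE; have := decr Co.
  by case: (boolP (i \in Co)) => [/inS /=|_] /=; lia.
move=> Co; rewrite repE -wiE; case: (boolP (i \in Co)) => [/inS->//|/notinS].
by rewrite ltnNge => /negbTE.
Qed.

(** The weights e_i with quota 1 represent [v], so the minimal sum is at most 1, while w_i >= q >=
    1. *)
Lemma minimal_rep_dictator i :
  (forall Co : {set 'I_n}, v Co = (i \in Co)) -> (\sum_j w j)%N = 1%N /\ w i = 1%N.
Proof.
move=> dict; have [q0 repE] := int_repP _ _ _ rep.
have : (\sum_j w j <= 1)%N.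
  have -> : 1%N = (\sum_j (j == i))%N.
    by rewrite (bigD1 i)//= eqxx big1// => j /negbTE->.
  apply: (@minimal_rep_sum 1); apply/int_repP; split=> // Co; rewrite dict.
  case: (boolP (i \in Co)) => iCo; first by rewrite (bigD1 i)//= eqxx.
  by rewrite big1// => j jCo; case: eqP jCo iCo => // ->->.
have := dict [set i]; rewrite set11 repE big_set1 => qwi.
have : (w i <= \sum_j w j)%N by rewrite (bigD1 i)//= leq_addr.
by lia.
Qed.

End MinimalRepresentation.

Lemma MSRI_eq1_or_le_half (R : realFieldType) n (v : game n) (p : 'rV[R]_n) i :
  simple_game v -> is_MSRI v p -> p 0 i = 1 \/ p 0 i <= 2^-1.
Proof.
move=> sv [s [ne0 [mins ->]]]; set Q := reps_of_sum v s in ne0 *.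
have vT := simple_game_setT sv.
have repP qw : qw \in Q -> [/\ int_rep v qw.1 (fun j => qw.2 j),
    (\sum_j qw.2 j)%N = s & forall s', (s' < \sum_j qw.2 j)%N -> reps_of_sum v s' = set0].
  by rewrite inE => /andP[rep /eqP sE]; split; rewrite ?sE.
have cardQ : 0 < #|Q|%:R :> R by rewrite ltr0n card_gt0.
have [/'forall_eqP dict|/negP ndict] := boolP [forall Co : {set 'I_n}, v Co == (i \in Co)].
  left; rewrite (eq_bigr (fun=> 1)) => [|qw /repP[rep sE min]].
    by rewrite sumr_const mulVf// gt_eqF.
  have [s1 w1] := minimal_rep_dictator vT rep min dict.
  by rewrite w1 -sE s1 divr1.
right; rewrite mulrC ler_pdivrMr//.
rewrite mulr_natr -sumr_const; apply: ler_sum => qw /repP[rep sE min].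
have [maj|] := ltnP (\sum_j qw.2 j) (2 * qw.2 i); last rewrite sE => le2.
  by case: ndict; apply/'forall_eqP; exact: minimal_rep_majority rep min _ maj.
have [/(congr1 (fun k => k%:R : R)) s0|s0] := posnP s.
  by rewrite s0 mulr0n invr0 mulr0 invr_ge0.
rewrite ler_pdivrMr ?ltr0n// -ler_pdivrMl ?invr_gt0// invrK.
by rewrite -natrM ler_nat.
Qed.

(** * Counting grid points in convex bodies *)

Lemma divmod_inj (k q q' r r' : nat) : (r < k)%N -> (r' < k)%N ->
  (k * q + r = k * q' + r')%N -> q = q' /\ r = r'.
Proof.
move=> rk r'k; rewrite ![(k * _)%N]mulnC => eqqr; have k0 := leq_ltn_trans (leq0n r) rk.
have := congr1 (divn^~ k) eqqr; have := congr1 (modn^~ k) eqqr.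
by rewrite /= !modnMDl !divnMDl// !modn_small// !divn_small// !addn0.
Qed.

(* Each block of k^d grid points meeting H is sent by y |-> (k'/k) y + b to a cube of side
   k'/m near Q, which holds k'^d grid points of Q; with z = k q + s coordinatewise,
   (z, r) |-> (t + k' q + r, s) is the resulting injection, t being the rounded translation
   part. *)
Lemma grid_card (R : archiRealFieldType) d B m k k' (b : 'rV[R]_d) (H Q : pred 'rV[R]_d) :
  (0 < m)%N -> (0 < k)%N -> (0 < k')%N ->
  (forall y, Q y -> forall l, `|y 0 l| <= B%:R) ->
  (forall y (u : 'rV[R]_d), H y ->
     (forall l, `|u 0 l - (k'%:R / k%:R * y 0 l + b 0 l)| * m%:R <= k'.+1%:R) -> Q u) ->
  (#|[set z : {ffun 'I_d -> 'I_(2 * B * m).+1} | H (grid_pt R z)]| * k' ^ d <=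
   #|[set z : {ffun 'I_d -> 'I_(2 * B * m).+1} | Q (grid_pt R z)]| * k ^ d)%N.
Proof.
move=> m0 k0 k'0 bndQ nearQ.
pose T := {ffun 'I_d -> 'I_(2 * B * m).+1}.
have mR : 0 < m%:R :> R by rewrite ltr0n.
have kR : 0 < k%:R :> R by rewrite ltr0n.
(* In terms of grid indices the map reads z |-> (k'/k) z + g. *)
pose g l : R := m%:R * b 0 l - k'%:R / k%:R * (B * m)%:R + (B * m)%:R.
pose t l : int := Num.floor (g l).
pose G (z : T) (r : {ffun 'I_d -> 'I_k'}) l : int := t l + (k' * (z l %/ k) + r l)%N%:Z.
pose f (p : T * {ffun 'I_d -> 'I_k'}) : T * {ffun 'I_d -> 'I_k} :=
  ([ffun l => inord `|G p.1 p.2 l|%N], [ffun l => Ordinal (ltn_pmod (p.1 l) k0)]).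
pose U z r : 'rV[R]_d := \row_l (((G z r l)%:~R - (B * m)%:R) / m%:R).
have QU z r : H (grid_pt R z) -> Q (U z r).
  move=> /nearQ; apply=> l; rewrite !mxE.
  rewrite -[X in _ * X](gtr0_norm mR) -normrM.
  (* The error has three parts: rounding in (-1, 0], [r] in [0, k' - 1] and -(k'/k)(z mod k) in
     [-k', 0]. This explains the tolerance k' + 1. *)
  have -> : (((G z r l)%:~R - (B * m)%:R) / m%:R -
     (k'%:R / k%:R * (((z l)%:R - (B * m)%:R) / m%:R) + b 0 l)) * m%:R =
     ((t l)%:~R - g l) + (r l)%:R - k'%:R / k%:R * (z l %% k)%:R :> R.
    rewrite {1}(divn_eq (z l) k) /G /g intrD -pmulrn !natrD !natrM; field.
    by rewrite !gt_eqF.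
  have /andP[tg gt] := floor_itv (g l); rewrite -/(t l) intrD in tg gt.
  have r0 : 0 <= (r l)%:R :> R by rewrite ler0n.
  have rk : (r l)%:R + 1 <= k'%:R :> R by rewrite natr1 ler_nat.
  have s0 : 0 <= k'%:R / k%:R * (z l %% k)%:R :> R by rewrite !mulr_ge0// invr_ge0.
  have sk : k'%:R / k%:R * (z l %% k)%:R <= k'%:R :> R.
    rewrite mulrAC ler_pdivrMr// ler_wpM2l// ler_nat ltnW// ltn_pmod//.
  rewrite -natr1 ler_norml; apply/andP; split; move: tg gt; rewrite mulr1z; lra.
(* Points of [Q] are bounded by [B], so the integer index is a valid grid index and [inord] and the
   absolute value lose nothing. *)
have Grange z r l : H (grid_pt R z) -> (0 <= G z r l <= (2 * B * m)%:Z).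
  move=> /(QU z r)/bndQ/(_ l); rewrite /U mxE normrM normfV (gtr0_norm mR) ler_pdivrMr//.
  rewrite ler_norml -natrM => /andP[lo hi].
  rewrite -!(ler_int R) mulr0z -pmulrn.
  by rewrite -mulnA natrM; apply/andP; split; lra.
have GE z r l : H (grid_pt R z) -> (inord `|G z r l|%N : 'I_(2 * B * m).+1) = `|G z r l|%N :> nat.
  by move=> /(Grange z r l)/andP[G0 GB]; rewrite inordK// ltnS -lez_nat gez0_abs.
have fQ z r : H (grid_pt R z) -> Q (grid_pt R (f (z, r)).1).
  move=> Hz; have := QU z r Hz; congr (Q _); apply/rowP => l; rewrite !mxE ffunE GE//.
  have /andP[G0 _] := Grange z r l Hz.
  by have -> : `|G z r l|%N%:R = (G z r l)%:~R :> R by rewrite pmulrn gez0_abs.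
rewrite -[X in (_ ^ X)%N](card_ord d) -[X in (X ^ _)%N](card_ord k') -card_ffun.
rewrite -[X in (_ <= _ * _ ^ X)%N](card_ord d) -[X in (_ <= _ * X ^ _)%N](card_ord k).
rewrite -card_ffun -!cardsT -!cardsX.
set D := setX _ _; rewrite -(card_in_imset (f := f) (D := mem D)); last first.
  move=> [z r] [z' r']; rewrite !inE !andbT /= => Hz Hz' [e1 e2].
  (* Division by k' recovers z div k and [r] from the first component; the second one stores z mod
     k. *)
  have eqzr l : z l = z' l /\ r l = r' l.
    have := congr1 (fun h : T => h l : nat) e1; rewrite !ffunE !GE// => eqG.
    have /andP[G0 _] := Grange z r l Hz; have /andP[G0' _] := Grange z' r' l Hz'.
    have : G z r l = G z' r' l by rewrite -[LHS]gez0_abs// eqG gez0_abs.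
    move=> /addrI [] /divmod_inj[]// eqq eqr; split; apply/val_inj => //=.
    rewrite (divn_eq (z l) k) (divn_eq (z' l) k) eqq.
    by have := congr1 (fun h : {ffun 'I_d -> 'I_k} => h l : nat) e2; rewrite !ffunE /= => ->.
  by congr pair; apply/ffunP => l; case: (eqzr l).
apply: subset_leq_card; apply/subsetP => _ /imsetP[[z r] + ->].
by rewrite !inE !andbT /= => Hz; exact: (fQ z r).
Qed.

(** Giving up part of the ratio, from (K+2)/K to (K+1)/K, leaves room to absorb the rounding in
    [grid_card] once the grid is fine. *)
Lemma grid_homothety (R : archiRealFieldType) k d B K (P : pred 'rV[R]_k)
    (a c : 'rV[R]_k) (A : 'M[R]_(d, k)) (y0 yc : 'rV[R]_d) (r : R) :
  (forall x y t, 0 <= t <= 1 -> P x -> P y -> P ((1 - t) *: x + t *: y)) ->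
  0 < r -> (forall y : 'rV[R]_d, (forall l, `|y 0 l - y0 0 l| <= r) -> P (a + y *m A)) ->
  (forall y : 'rV[R]_d, P (a + y *m A) -> forall l, `|y 0 l| <= B%:R) ->
  (0 < K)%N -> c = a + yc *m A ->
  exists M, forall m, (M <= m)%N ->
    (#|[set z : {ffun 'I_d -> 'I_(2 * B * m).+1} |
         P (c + (1 + 2 / K%:R) *: (a + grid_pt R z *m A - c))%R]| * K.+1 ^ d <=
     #|[set z : {ffun 'I_d -> 'I_(2 * B * m).+1} | P (a + grid_pt R z *m A)%R]| * K ^ d)%N.
Proof.
move=> cvx r0 box bnd K0 cE.
(* For such m the rounding error (K+2)/m, magnified by 1/th = K+2, stays within the radius [r] of
   the box. *)
exists (Num.bound (K.+2%:R ^+ 2 / r)).+1 => m mM.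
have m0 : (0 < m)%N by apply: leq_trans mM.
have mr : K.+2%:R ^+ 2 <= r * m%:R :> R.
  rewrite mulrC -ler_pdivrMr// ltW//.
  apply: lt_le_trans (archi_boundP _) _; first by rewrite divr_ge0 ?exprn_ge0 ?ler0n// ltW.
  by rewrite ler_nat ltnW.
have KR : 0 < K%:R :> R by rewrite ltr0n.
(* Mixing in the interior point y0 with weight th turns the homothety of ratio (K+2)/K
   into one of ratio (K+1)/K whose image keeps a distance th * r to the boundary. *)
pose lam : R := 1 + 2 / K%:R; pose th : R := K.+2%:R^-1.
have K2R : K.+2%:R = K%:R + 2 :> R by rewrite -addn2 natrD.
have K1R : K.+1%:R = K%:R + 1 :> R by rewrite -addn1 natrD.
have K2n0 : K%:R + 2 != 0 :> R by rewrite gt_eqF//; lra.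
apply: (@grid_card _ _ _ _ _ _ ((1 - th) * (1 - lam) *: yc + th *: y0)
  (fun y => P (c + lam *: (a + y *m A - c))) (fun y => P (a + y *m A))) => //.
move=> y u; set pt := c + _ => Ppt near_u.
(* Chosen so that [u] is the mixture, with weight [th] on [y1], of the homothetic image of [y] and
   [y1]. *)
pose y1 := y0 + th^-1 *: (u - (K.+1%:R / K%:R *: y + ((1 - th) * (1 - lam) *: yc + th *: y0))).
have Py1 : P (a + y1 *m A).
  apply: box => l; rewrite !mxE addrAC subrr add0r /th invrK normrM.
  rewrite -(ler_pM2r (_ : 0 < m%:R)) ?ltr0n// -mulrA.
  apply: le_trans mr; rewrite expr2 ger0_norm// ler_wpM2l//.
  by have := near_u l; rewrite !mxE => /le_trans; apply; rewrite ler_nat.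
have -> : a + u *m A = (1 - th) *: pt + th *: (a + y1 *m A).
  have -> : pt = a + (yc + lam *: (y - yc)) *m A.
    rewrite /pt cE mulmxDl -scalemxAl mulmxBl.
    by apply/rowP => l; rewrite !mxE; ring.
  have {1}-> : u = (1 - th) *: (yc + lam *: (y - yc)) + th *: y1.
    apply/rowP => l; rewrite !mxE /th /lam K1R K2R; field.
    by rewrite K2n0 gt_eqF.
  rewrite mulmxDl -!scalemxAl.
  move: ((yc + _) *m A) (y1 *m A) => X Y.
  by apply/rowP => l; rewrite !mxE; ring.
apply: cvx => //; rewrite /th invr_ge0 ler0n /= invf_le1 ?ltr0n//.
by rewrite ler1n.
Qed.

(* Bernoulli's inequality (1 + 1/K)^d >= 1 + d/K *)
Lemma exp_succ_ratio K d : (K ^ d * (K + d) <= K * K.+1 ^ d)%N.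
Proof.
elim: d => [|d IH]; first by rewrite !expn0 addn0 mul1n muln1.
rewrite !expnS; have := leq_mul (leqnn K.+1) IH.
move: (K ^ d)%N (K.+1 ^ d)%N => x y; nia.
Qed.

(** Bernoulli gives h (K + d) <= q K, and d >= 2 K^2 turns this into h * 2K <= q. *)
Lemma card_ratio K d h q : (0 < K)%N -> (2 * K ^ 2 <= d)%N ->
  (h * K.+1 ^ d <= q * K ^ d)%N -> (h * (2 * K) <= q)%N.
Proof.
move=> K0 Kd le_hq.
have le1 : (h * (K + d) <= q * K)%N.
  rewrite -(leq_pmul2l (_ : 0 < K.+1 ^ d)%N) ?expn_gt0//.
  apply: (@leq_trans (q * (K ^ d * (K + d)))).
    by rewrite mulnCA !mulnA leq_mul2r le_hq orbT.
  by rewrite [leqRHS]mulnCA leq_mul2l [(_ ^ _ * K)%N]mulnC exp_succ_ratio orbT.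
rewrite -(leq_pmul2r K0); apply: leq_trans le1; rewrite -mulnA leq_mul2l.
by apply/orP; right; move: Kd; rewrite expnS expn1; nia.
Qed.

(** Grid points with x_i > 1/2 + eps/2 are charged to [c0] or [c1]. Each centre accounts for at most
    1/(2K) of all points, together at most 1/K <= eps/4. The grid average is thus at most 1/2 + 3
    eps/4, and the last eps/4 is the convergence tolerance. *)
Lemma centroid_le (R : archiRealFieldType) k (P : pred 'rV[R]_k) (c c0 c1 : 'rV[R]_k)
    (i : 'I_k) (eps : R) K :
  is_centroid P c ->
  (forall x y t, 0 <= t <= 1 -> P x -> P y -> P ((1 - t) *: x + t *: y)) ->
  (forall x, P x -> x 0 i <= 1) ->
  (0 < K)%N -> 4 <= K%:R * eps ->
  (forall d (a : 'rV[R]_k) (A : 'M[R]_(d, k)),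
     (forall x, P x -> exists y : 'rV[R]_d, x = a + y *m A) -> (2 * K ^ 2 <= d)%N) ->
  (forall x, P x -> 2^-1 + eps / 2 < x 0 i ->
     (P c0 && P (c0 + (1 + 2 / K%:R) *: (x - c0))) ||
     (P c1 && P (c1 + (1 + 2 / K%:R) *: (x - c1)))) ->
  c 0 i <= 2^-1 + eps.
Proof.
move=> [d [a [A [B [freeA affP [y0 [r [r0 box]]] bnd avg]]]]] cvx le1 K0 Keps dimP bad.
have KR : 0 < K%:R :> R by rewrite ltr0n.
have eps0 : 0 < eps by rewrite -(pmulr_rgt0 _ KR); lra.
have Kd := dimP _ _ _ affP.
have [M avgM] := avg _ (divr_gt0 eps0 (ltr0n R 4)).
pose phi m (z : {ffun 'I_d -> 'I_(2 * B * m).+1}) := a + grid_pt R z *m A.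
pose h cc x := P cc && P (cc + (1 + 2 / K%:R) *: (x - cc)).
have count cc : exists Mc, forall m, (Mc <= m)%N ->
    (#|[set z | P (phi m z) && h cc (phi m z)]| * (2 * K) <= #|[set z | P (phi m z)]|)%N.
  have [Pcc|nPcc] := boolP (P cc); last first.
    by exists 0%N => m _; rewrite (_ : [set z | _] = set0) ?cards0//; apply/setP => z;
       rewrite !inE /h (negbTE nPcc) andbF.
  have [yc ycE] := affP _ Pcc.
  have [Mc cnt] := grid_homothety cvx r0 box bnd K0 ycE.
  exists Mc => m /cnt le_m; apply: card_ratio K0 Kd _.
  apply: leq_trans le_m; rewrite leq_mul2r; apply/orP; right.
  apply: subset_leq_card; apply/subsetP => z; rewrite !inE => /andP[_ /andP[]].
  by [].
have [M0 cnt0] := count c0; have [M1 cnt1] := count c1.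
pose m := maxn M (maxn M0 M1).
have /(avgM m)/(_ i) : (M <= m)%N by rewrite leq_maxl.
have {cnt0}cnt0 := cnt0 m ltac:(by rewrite /m !leq_max leqnn !orbT).
have {cnt1}cnt1 := cnt1 m ltac:(by rewrite /m !leq_max leqnn !orbT).
pose Q := [set z | P (phi m z)]; rewrite -/Q in cnt0 cnt1.
rewrite -[#|[set z | _]|]/#|Q|; set S := \sum_(z | _) _.
have indic (b : pred {ffun 'I_d -> 'I_(2 * B * m).+1}) :
    \sum_(z | P (phi m z)) (b z)%:R = #|[set z | P (phi m z) && b z]|%:R :> R.
  rewrite -natr_sum -sum1_card; congr (_%:R); rewrite [LHS]big_mkcond [RHS]big_mkcond.
  by apply: eq_bigr => z _; rewrite inE; case: (P _); case: (b z).
have leS : S <= (2^-1 + eps / 2) * #|Q|%:R + #|[set z | P (phi m z) && h c0 (phi m z)]|%:R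
   + #|[set z | P (phi m z) && h c1 (phi m z)]|%:R.
  rewrite -(indic (fun z => h c0 (phi m z))) -(indic (fun z => h c1 (phi m z))); have -> : (2^-1 + eps / 2) * #|Q|%:R =
      \sum_(z | P (phi m z)) (2^-1 + eps / 2).
    by rewrite sumr_const mulr_natr; congr (_ *+ _); apply: eq_card => z; rewrite inE.
  rewrite -!big_split; apply: ler_sum => z Pz /=; rewrite -/(phi m z).
  have h_ge0 cc : 0 <= (h cc (phi m z))%:R :> R by rewrite ler0n.
  have := le1 _ Pz; have [le_z|/(bad _ Pz)/orP[hz|hz]] := leP (phi m z 0 i) (2^-1 + eps / 2).
  - by have := h_ge0 c0; have := h_ge0 c1; lra.
  - by rewrite {1}/h hz /=; have := h_ge0 c1; lra.
  - by rewrite {2}/h hz /=; have := h_ge0 c0; lra.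
rewrite -(ler_nat R) !natrM in cnt0; rewrite -(ler_nat R) !natrM in cnt1.
have le_avg : S / #|Q|%:R <= 2^-1 + 3 / 4 * eps.
  have [Q0|Q0] := posnP #|Q|; first by rewrite Q0 invr0 mulr0; lra.
  rewrite ler_pdivrMr ?ltr0n//; apply: le_trans leS _.
  move: cnt0 cnt1; move: #|[set z | _ & h c0 _]|%:R #|[set z | _ & h c1 _]|%:R => h0 h1.
  have : 0 < #|Q|%:R :> R by rewrite ltr0n.
  move: #|Q|%:R => q q0 le0 le1'.
  suff : (h0 + h1) * K%:R <= (eps / 4 * q) * K%:R by rewrite ler_pM2r//; lra.
  have : 4 * q <= K%:R * eps * q by rewrite ler_pM2r.
  by lra.
by rewrite ltr_norml => /andP[lo _]; lra.
Qed.

(** * The weight polytopes *)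

(** Since there are finitely many losing coalitions, their strict inequalities share a slack [e], by
    which a single weight may later be raised. *)
Lemma weighted_slack (R : realFieldType) n (v : game n) : weighted_game R v ->
  exists (w : 'rV[R]_n) (q e : R),
  [/\ 0 < q, 0 < e, forall j, 0 <= w 0 j,
      forall Co, v Co -> q <= wsum w Co &
      forall Co, ~~ v Co -> wsum w Co + e <= q].
Proof.
move=> [_ [w [q [q0 [w0 vE]]]]].
have [e e0 eP] := @pos_lower_bound R {set 'I_n} (fun Co => ~~ v Co)
  (fun Co => q - wsum w Co)
  ltac:(by move=> Co /=; rewrite vE -ltNge subr_gt0).
exists w, q, e; split=> // Co; first by rewrite vE.
by move/eP; lra.
Qed.

(* The rows of [a; A] span the linear hull of the affine hull of P, in particular every
   difference e *: delta_mx 0 j of points of the cone over P. *)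
Lemma cone_dimension (R : fieldType) n k d (a : 'rV[R]_k) (A : 'M[R]_(d, k))
    (E : 'M[R]_(k, n)) (w : 'rV[R]_n) (e : R) (P : 'rV[R]_n -> Prop) :
  (forall x, P x -> exists (y : 'rV[R]_d) (t : R), x = t *: ((a + y *m A) *m E)) ->
  e != 0 -> P w -> (forall j, P (w + e *: delta_mx 0 j)) -> (n <= d.+1)%N.
Proof.
move=> affP e0 Pw Pe; pose M := col_mx a A *m E.
have sub x : P x -> (x <= M)%MS.
  move=> /affP[y [t ->]]; apply: scalemx_sub; rewrite submxMr//.
  have -> : a + y *m A = row_mx 1%:M y *m col_mx a A by rewrite mul_row_col mul1mx.
  exact: submxMl.
rewrite -(mxrank1 R n); apply: leq_trans (rank_leq_row M); apply: mxrankS.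
apply/row_subP => j; rewrite rowE mulmx1.
have -> : delta_mx 0 j = e^-1 *: ((w + e *: delta_mx 0 j) - w).
  by rewrite addrC addKr scalerA mulVf// scale1r.
by rewrite scalemx_sub// addmx_sub ?eqmx_opp ?sub.
Qed.

(** * Convexity and homotheties of the weight polytopes *)

Section Polytopes.
Variables (R : realFieldType) (n : nat) (v : game n).
Hypothesis sv : simple_game v.
Implicit Types (w : 'rV[R]_n) (x : 'rV[R]_n.+1).

Lemma PwP w : reflect
  [/\ forall j, 0 <= w 0 j, wsum w setT = 1 &
      forall Co Ct, minimal_winning v Co -> maximal_losing v Ct -> wsum w Ct <= wsum w Co]
  (Pw v w).
Proof.
apply: (iffP and3P) => [[/forallP w0 /eqP w1 /'forall_forallP le]|[w0 w1 le]].
  by split=> // Co Ct mCo mCt; have := le Co Ct; rewrite mCo mCt.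
split; [exact/forallP | exact/eqP | apply/'forall_forallP => Co Ct].
by apply/implyP => /andP[]; exact: le.
Qed.

Lemma PrP x : reflect
  [/\ forall j, 0 <= x 0 j, wsum (rep_w x) setT = 1, x 0 ord0 <= 1,
      forall Co, minimal_winning v Co -> x 0 ord0 <= wsum (rep_w x) Co &
      forall Ct, maximal_losing v Ct -> wsum (rep_w x) Ct <= x 0 ord0]
  (Pr v x).
Proof.
apply: (iffP and5P) => [[/forallP w0 /eqP w1 q1 /forallP win /forallP lose]|[w0 w1 q1 win lose]].
  by split=> // C mC; [have := win C|have := lose C]; rewrite mC.
by split=> //; [exact/forallP | exact/eqP | apply/forallP => Co; apply/implyP..];
   [exact: win | exact: lose].
Qed.

Lemma rep_wD x y : rep_w (x + y) = rep_w x + rep_w y.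
Proof. by apply/rowP => j; rewrite !mxE. Qed.

Lemma rep_wZ t x : rep_w (t *: x) = t *: rep_w x.
Proof. by apply/rowP => j; rewrite !mxE. Qed.

Lemma rep_w_ge0 x : (forall k, 0 <= x 0 k) -> forall j, 0 <= rep_w x 0 j.
Proof. by move=> x0 j; rewrite mxE. Qed.

Lemma convex_ge0 (t a b : R) : 0 <= t <= 1 -> 0 <= a -> 0 <= b -> 0 <= (1 - t) * a + t * b.
Proof. by move=> /andP[t0 t1] a0 b0; rewrite addr_ge0// mulr_ge0// subr_ge0. Qed.

Lemma Pw_convex w w' t : 0 <= t <= 1 -> Pw v w -> Pw v w' -> Pw v ((1 - t) *: w + t *: w').
Proof.
move=> t01 /PwP[w0 w1 le] /PwP[w0' w1' le']; apply/PwP; split.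
- by move=> j; rewrite !mxE convex_ge0.
- by rewrite wsumD !wsumZ w1 w1'; lra.
move=> Co Ct mCo mCt; rewrite !wsumD !wsumZ -subr_ge0.
have := convex_ge0 t01 (_ : 0 <= wsum w Co - wsum w Ct) (_ : 0 <= wsum w' Co - wsum w' Ct).
by rewrite !subr_ge0 le// le'// => /(_ isT isT); lra.
Qed.

Lemma Pr_convex x x' t : 0 <= t <= 1 -> Pr v x -> Pr v x' -> Pr v ((1 - t) *: x + t *: x').
Proof.
move=> t01 /PrP[x0 x1 q1 win lose] /PrP[x0' x1' q1' win' lose']; apply/PrP; split.
- by move=> j; rewrite !mxE convex_ge0.
- by rewrite rep_wD !rep_wZ wsumD !wsumZ x1 x1'; lra.
- rewrite !mxE -subr_ge0; have := convex_ge0 t01 (_ : 0 <= 1 - x 0 ord0) (_ : 0 <= 1 - x' 0 ord0).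
  by rewrite !subr_ge0 q1 q1' => /(_ isT isT); lra.
- move=> Co mCo; rewrite !mxE rep_wD !rep_wZ wsumD !wsumZ -subr_ge0.
  have := convex_ge0 t01 (_ : 0 <= wsum (rep_w x) Co - x 0 ord0)
     (_ : 0 <= wsum (rep_w x') Co - x' 0 ord0).
  by rewrite !subr_ge0 win// win'// => /(_ isT isT); lra.
- move=> Ct mCt; rewrite !mxE rep_wD !rep_wZ wsumD !wsumZ -subr_ge0.
  have := convex_ge0 t01 (_ : 0 <= x 0 ord0 - wsum (rep_w x) Ct)
     (_ : 0 <= x' 0 ord0 - wsum (rep_w x') Ct).
  by rewrite !subr_ge0 lose// lose'// => /(_ isT isT); lra.
Qed.

Lemma Pw_le1 w i : Pw v w -> w 0 i <= 1.
Proof. by move=> /PwP[w0 w1 _]; rewrite -w1 wsum_ge1// inE. Qed.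

Lemma Pr_le1 x i : Pr v x -> x 0 (lift ord0 i) <= 1.
Proof.
move=> /PrP[x0 x1 _ _ _]; rewrite -x1.
by have := wsum_ge1 (rep_w_ge0 x0) (in_setT i); rewrite mxE.
Qed.

Lemma delta_homothety_ge0 w lam i : (forall j, 0 <= w 0 j) -> 0 <= lam ->
  2 * (lam * (1 - w 0 i)) <= 1 ->
  forall j, 0 <= (delta_mx 0 i + lam *: (w - delta_mx 0 i)) 0 j.
Proof.
move=> w0 lam0 lam1 j; rewrite !mxE eqxx /=; have [->|ji] := eqVneq j i.
  by rewrite /=; lra.
by rewrite add0r subr0 mulr_ge0.
Qed.

(* The homothety centred at e_i sends the part of the polytope where i has more than half
   of the weight back into it as long as i keeps half of the weight: each constraint
   either is invariant (both or neither sides contain i) or already follows from i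
   having half of the weight. *)
Lemma Pw_homothety w lam i : Pw v w -> 1 <= lam -> 2^-1 < w 0 i ->
  2 * (lam * (1 - w 0 i)) <= 1 ->
  Pw v (delta_mx 0 i : 'rV[R]_n) && Pw v (delta_mx 0 i + lam *: (w - delta_mx 0 i)).
Proof.
move=> /PwP[w0 w1 le] lam1 wi lamw; have lam0 : 0 <= lam by lra.
have cross Co Ct : minimal_winning v Co -> maximal_losing v Ct -> i \in Ct -> i \in Co.
  move=> mCo mCt iCt; apply: contraT => iCo; have := le _ _ mCo mCt.
  by have := wsum_notin w0 iCo; have := wsum_ge1 w0 iCt; rewrite w1; lra.
set u := _ + _; have u0 : forall j, 0 <= u 0 j by exact: delta_homothety_ge0.
have uE Co : wsum u Co = (i \in Co)%:R + lam * (wsum w Co - (i \in Co)%:R).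
  by rewrite /u wsumD wsumZ wsumB wsum_delta.
have u1 : wsum u setT = 1 by rewrite uE inE w1 subrr mulr0 addr0.
have ui : u 0 i = 1 + lam * (w 0 i - 1) by rewrite -wsum1 uE set11 wsum1.
apply/andP; split; apply/PwP; split=> //.
- by move=> j; rewrite mxE ler0n.
- by rewrite wsum_delta inE.
- by move=> Co Ct mCo mCt; rewrite !wsum_delta ler_nat; case: (boolP (i \in Ct)) => // /cross->.
move=> Co Ct mCo mCt; have [iCt|iCt] := boolP (i \in Ct).
  rewrite !uE iCt (cross _ _ mCo mCt iCt) lerD2l ler_wpM2l// lerD2r.
  exact: le.
have [iCo|iCo] := boolP (i \in Co).
  by have := wsum_notin u0 iCt; have := wsum_ge1 u0 iCo; rewrite u1 ui; lra.
by rewrite !uE (negbTE iCt) (negbTE iCo) !add0r !subr0 ler_wpM2l// le.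
Qed.

(** The point (q, w) = (b, e_i), with quota 0 or 1. *)
Definition rep_vertex (b : bool) i : 'rV[R]_n.+1 :=
  \row_k oapp (fun j => (j == i)%:R) b%:R (unlift ord0 k).

Lemma rep_vertex0 b i : rep_vertex b i 0 ord0 = b%:R.
Proof. by rewrite mxE unlift_none. Qed.

Lemma rep_w_vertex b i : rep_w (rep_vertex b i) = delta_mx 0 i.
Proof. by apply/rowP => j; rewrite !mxE liftK. Qed.

(** With quota 1 every winning coalition contains [i]; with quota 0 every losing one omits [i].
    Constraints tight at the centre are merely scaled; the others follow by comparing the new quota
    with the new weight of [i], using the last hypothesis. *)
Lemma Pr_homothety x lam i (b : bool) : Pr v x -> 1 <= lam -> 2^-1 < x 0 (lift ord0 i) ->
  2 * (lam * (1 - x 0 (lift ord0 i))) <= 1 ->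
  (if b then ~~ v [set~ i] else v [set i]) ->
  lam * (1 - x 0 (lift ord0 i) + (if b then 1 - x 0 ord0 else x 0 ord0)) <= 1 ->
  Pr v (rep_vertex b i) && Pr v (rep_vertex b i + lam *: (x - rep_vertex b i)).
Proof.
move=> /PrP[x0 x1 q1 win lose] lam1 xi lamx vb lamq; have lam0 : 0 <= lam by lra.
have [mono _] := sv.
set c := rep_vertex b i; set y := c + _.
have w0 := rep_w_ge0 x0.
have wi : rep_w x 0 i = x 0 (lift ord0 i) by rewrite mxE.
have rc : rep_w c = delta_mx 0 i := rep_w_vertex b i.
have c0 : c 0 ord0 = b%:R := rep_vertex0 b i.
have ry : rep_w y = delta_mx 0 i + lam *: (rep_w x - delta_mx 0 i).
  by rewrite /y rep_wD rep_wZ rep_wD -scaleN1r rep_wZ scaleN1r rc.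
have y0 : y 0 ord0 = b%:R + lam * (x 0 ord0 - b%:R) by rewrite -c0 /y; move: (c) => c'; rewrite !mxE.
have u0 : forall j, 0 <= rep_w y 0 j by rewrite ry; apply: delta_homothety_ge0; rewrite ?wi.
have uE Co : wsum (rep_w y) Co = (i \in Co)%:R + lam * (wsum (rep_w x) Co - (i \in Co)%:R).
  by rewrite ry wsumD wsumZ wsumB wsum_delta.
have u1 : wsum (rep_w y) setT = 1 by rewrite uE inE x1 subrr mulr0 addr0.
have ui : rep_w y 0 i = 1 + lam * (x 0 (lift ord0 i) - 1) by rewrite -wsum1 uE set11 wsum1 wi.
have inb Co : minimal_winning v Co -> b -> i \in Co.
  move=> /andP[vCo _] tb; move: vb; rewrite tb; apply: contraNT => iCo.
  exact: mono (subset_setC1 iCo) vCo.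
have notinb Ct : maximal_losing v Ct -> ~~ b -> i \notin Ct.
  move=> /andP[vCt _] /negbTE fb; move: vb; rewrite fb => vi; apply: contra vCt => iCt.
  by apply: mono vi; rewrite sub1set.
have winy Co : minimal_winning v Co -> y 0 ord0 <= wsum (rep_w y) Co.
  move=> mCo; have := win _ mCo; have := inb _ mCo; rewrite y0.
  case: (boolP (i \in Co)) => [iCo _|iCo].
    case: (b) lamq => lamq le_q.
      by rewrite uE iCo lerD2l ler_wpM2l// lerD2r.
    by apply: le_trans (wsum_ge1 u0 iCo); rewrite ui /= mulr0n; lra.
  case: (b) => [/(_ isT)//|_ le_q].
  by rewrite uE (negbTE iCo) lerD2l ler_wpM2l// lerD2r.
have losey Ct : maximal_losing v Ct -> wsum (rep_w y) Ct <= y 0 ord0.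
  move=> mCt; have := lose _ mCt; have := notinb _ mCt; rewrite y0.
  case: (boolP (i \in Ct)) => iCt.
    case: (b) => [_|/(_ isT)//] le_q.
    by rewrite uE iCt lerD2l ler_wpM2l// lerD2r.
  case: (b) lamq => lamq _ le_q.
    by apply: le_trans (wsum_notin u0 iCt) _; rewrite u1 ui /=; lra.
  by rewrite uE (negbTE iCt) lerD2l ler_wpM2l// lerD2r.
(* These two coalitions confine the new quota to [0, 1]. *)
have [Co _ mCo] := minimal_winning_exists (simple_game_setT sv).
have [Ct _ mCt] := maximal_losing_exists (simple_game_set0 sv).
apply/andP; split; apply/PrP; split=> //.
- by move=> k; rewrite mxE; case: unlift => [j|]; rewrite /= ler0n.
- by rewrite rc wsum_delta inE.
- by rewrite c0; case: (b).
- move=> Cs mCs; rewrite c0 rc wsum_delta ler_nat.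
  by case: (b) (inb _ mCs) => // /(_ isT)->.
- move=> Cs mCs; rewrite c0 rc wsum_delta ler_nat.
  by case: (b) (notinb _ mCs) => [|/(_ isT)/negbTE->//]; rewrite leq_b1.
- move=> k; case: (unliftP ord0 k) => [j|] ->; first by have := u0 j; rewrite mxE.
  by apply: le_trans (losey _ mCt); exact: wsum_ge0.
- by apply: le_trans (winy _ mCo) _; rewrite -u1 le_wsumT.
Qed.

(** Otherwise a maximal losing coalition through [i] would outweigh the quota. This and the next
    lemma make the centre on the quota's side of 1/2 admissible. *)
Lemma Pr_quota_small x i : Pr v x -> 2^-1 < x 0 (lift ord0 i) -> x 0 ord0 <= 2^-1 -> v [set i].
Proof.
move=> /PrP[x0 _ _ _ lose] xi qs; apply: contraT => /maximal_losing_exists[Ct sub /lose].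
have iCt : i \in Ct by rewrite -sub1set.
by have := wsum_ge1 (rep_w_ge0 x0) iCt; rewrite mxE; lra.
Qed.

Lemma Pr_quota_large x i : Pr v x -> 2^-1 < x 0 (lift ord0 i) -> 2^-1 <= x 0 ord0 ->
  ~~ v [set~ i].
Proof.
move=> /PrP[x0 x1 _ win _] xi ql; apply/negP => /minimal_winning_exists[Co sub /win].
have iCo : i \notin Co by apply/negP => /(subsetP sub); rewrite !inE eqxx.
by have := wsum_notin (rep_w_ge0 x0) iCo; rewrite mxE x1; lra.
Qed.

End Polytopes.

(** * Dimension of the weight polytopes *)

Lemma Pw_rep_w (R : realFieldType) n (v : game n) (x : 'rV[R]_n.+1) :
  Pr v x -> Pw v (rep_w x).
Proof.
move=> /PrP[x0 x1 _ win lose]; apply/PwP; split=> //; first exact: rep_w_ge0.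
by move=> Co Ct /win qCo /lose Ctq; exact: le_trans qCo.
Qed.

(** Unnormalised weights, so that one weight can be raised without restoring the sum 1. *)
Definition representing (R : realFieldType) n (v : game n) (w : 'rV[R]_n) : Prop :=
  (forall j, 0 <= w 0 j) /\
  exists q, [/\ 0 < q, forall Co, v Co -> q <= wsum w Co & forall Co, ~~ v Co -> wsum w Co <= q].

Lemma representing_Pr (R : realFieldType) n (v : game n) (w : 'rV[R]_n) :
  simple_game v -> representing v w ->
  exists2 x : 'rV[R]_n.+1, Pr v x & w = wsum w setT *: rep_w x.
Proof.
move=> sv [w0 [q [q0 win lose]]]; set s := wsum w setT.
have qs : q <= s by apply/win/simple_game_setT.
have s0 : 0 < s by exact: lt_le_trans qs.
pose x : 'rV[R]_n.+1 := \row_k oapp (fun j => w 0 j / s) (q / s) (unlift ord0 k).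
have xE : rep_w x = s^-1 *: w by apply/rowP => j; rewrite !mxE liftK /= mulrC.
have x0 : x 0 ord0 = q / s by rewrite mxE unlift_none.
exists x; last by rewrite xE scalerA divff ?gt_eqF// scale1r.
apply/PrP; rewrite xE x0; split.
- by move=> k; rewrite mxE; case: unlift => [j|] /=; rewrite divr_ge0// ltW.
- by rewrite wsumZ mulVf// gt_eqF.
- by rewrite ler_pdivrMr// mul1r.
- by move=> Co /andP[vCo _]; rewrite wsumZ mulrC ler_pM2l ?invr_gt0// win.
- by move=> Ct /andP[vCt _]; rewrite wsumZ [leRHS]mulrC ler_pM2l ?invr_gt0// lose.
Qed.

(** By the slack [e], the vectors w and w + e e_j all lie in the cone and their differences span the
    whole space. [E] is the identity for P^w and drops the quota for P^r. *)
Lemma representing_dimension (R : realFieldType) n k d (v : game n) (a : 'rV[R]_k)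
    (A : 'M[R]_(d, k)) (E : 'M[R]_(k, n)) : weighted_game R v ->
  (forall w, representing v w -> exists (y : 'rV[R]_d) (t : R), w = t *: ((a + y *m A) *m E)) ->
  (n <= d.+1)%N.
Proof.
move=> wv affP; have [w [q [e [q0 e0 w0 win lose]]]] := weighted_slack wv.
apply: (cone_dimension affP (lt0r_neq0 e0) (w := w)).
  by split=> //; exists q; split=> // Co /lose; lra.
move=> i; split.
  by move=> j; rewrite !mxE addr_ge0// mulr_ge0 ?ler0n// ltW.
exists q; split=> // Co; rewrite wsumD wsumZ wsum_delta.
  by move=> /win qCo; apply: le_trans qCo _; rewrite lerDl mulr_ge0// ltW.
move=> /lose; apply: le_trans; rewrite lerD2l.
by case: (i \in Co); rewrite ?mulr1// mulr0 ltW.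
Qed.

Lemma Pw_dimension (R : realFieldType) n d (v : game n) (a : 'rV[R]_n) (A : 'M[R]_(d, n)) :
  weighted_game R v -> (forall w, Pw v w -> exists y : 'rV[R]_d, w = a + y *m A) ->
  (n <= d.+1)%N.
Proof.
move=> wv affP; apply: (@representing_dimension _ _ _ _ _ a A 1%:M wv) => w.
move=> /(representing_Pr wv.1)[x /Pw_rep_w/affP[y xE] ->].
by exists y, (wsum w setT); rewrite mulmx1 xE.
Qed.

Lemma Pr_dimension (R : realFieldType) n d (v : game n) (a : 'rV[R]_n.+1)
    (A : 'M[R]_(d, n.+1)) :
  weighted_game R v -> (forall x, Pr v x -> exists y : 'rV[R]_d, x = a + y *m A) ->
  (n <= d.+1)%N.
Proof.
move=> wv affP; pose E : 'M[R]_(n.+1, n) := \matrix_(k, j) (k == lift ord0 j)%:R.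
have rep_wE (x : 'rV[R]_n.+1) : rep_w x = x *m E.
  apply/rowP => j; rewrite !mxE (bigD1 (lift ord0 j))//= mxE eqxx mulr1 big1 ?addr0//.
  by move=> k kj; rewrite mxE (negbTE kj) mulr0.
apply: (@representing_dimension _ _ _ _ _ a A E wv) => w.
move=> /(representing_Pr wv.1)[x /affP[y xE] ->].
by exists y, (wsum w setT); rewrite rep_wE xE.
Qed.

(** * Bounds for AWI and ARI *)

Lemma scale_pos (R : realFieldType) (eps : R) K :
  (0 < K)%N -> 4 <= K%:R * eps -> 0 < eps.
Proof.
by move=> K0 Keps; rewrite -(@pmulr_rgt0 _ K%:R) ?ltr0n//; lra.
Qed.

(** Because 2/K <= eps/2, the ratio is at most 1 + eps/2, and (1 + eps/2)(1 - eps/2) <= 1. *)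
Lemma homothety_ratio_le (R : realFieldType) (eps a : R) K :
  (0 < K)%N -> 4 <= K%:R * eps -> a <= 1 - eps / 2 -> (1 + 2 / K%:R) * a <= 1.
Proof.
move=> K0 Keps ale; have KR : 0 < K%:R :> R by rewrite ltr0n.
have : 0 < eps by exact: scale_pos K0 Keps.
have : 4 / K%:R <= eps by rewrite ler_pdivrMr// mulrC.
have : 0 < K%:R^-1 :> R by rewrite invr_gt0.
move: K%:R^-1 => k k0 keps eps0.
have : (1 + 2 * k) * a <= (1 + 2 * k) * (1 - eps / 2) by rewrite ler_pM2l//; lra.
have : 0 <= k * eps by rewrite mulr_ge0 ?ltW.
by lra.
Qed.

Lemma AWI_le (R : archiRealFieldType) n (v : game n) (c : 'rV[R]_n) i (eps : R) K :
  weighted_game R v -> is_AWI v c -> (0 < K)%N -> 4 <= K%:R * eps ->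
  (2 * K ^ 2 < n)%N -> c 0 i <= 2^-1 + eps.
Proof.
move=> wv cc K0 Keps Kn; have sv := wv.1.
apply: (centroid_le (c0 := delta_mx 0 i) (c1 := delta_mx 0 i) cc _ _ K0 Keps).
- by move=> *; exact: Pw_convex.
- by move=> *; exact: (@Pw_le1 _ _ v).
(* Since n <= d + 1, the strict bound 2 K^2 < n yields 2 K^2 <= d. *)
- by move=> d a A /(Pw_dimension wv) le_nd; rewrite -ltnS; exact: leq_trans Kn le_nd.
have eps0 := scale_pos K0 Keps.
move=> w Pw_w wi; apply/orP; left; apply: Pw_homothety => //.
- by rewrite lerDl divr_ge0.
- by lra.
by rewrite mulrCA; apply: homothety_ratio_le K0 Keps _; lra.
Qed.

Lemma ARI_le (R : archiRealFieldType) n (v : game n) (c : 'rV[R]_n.+1) i (eps : R) K :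
  weighted_game R v -> is_ARI v c -> (0 < K)%N -> 4 <= K%:R * eps ->
  (2 * K ^ 2 < n)%N -> c 0 (lift ord0 i) <= 2^-1 + eps.
Proof.
move=> wv cc K0 Keps Kn; have sv := wv.1.
apply: (centroid_le (c0 := rep_vertex R false i) (c1 := rep_vertex R true i) cc _ _ K0 Keps).
- by move=> *; exact: Pr_convex.
- by move=> *; exact: (@Pr_le1 _ _ v).
- by move=> d a A /(Pr_dimension wv) le_nd; rewrite -ltnS; exact: leq_trans Kn le_nd.
have eps0 := scale_pos K0 Keps.
move=> x Px xi; have xi2 : 2^-1 < x 0 (lift ord0 i) by lra.
have lam1 : 1 <= 1 + 2 / K%:R :> R by rewrite lerDl divr_ge0.
have lamx : 2 * ((1 + 2 / K%:R) * (1 - x 0 (lift ord0 i))) <= 1.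
  by rewrite mulrCA; apply: homothety_ratio_le K0 Keps _; lra.
(* The centre whose quota is nearer is used: the quota is then at distance at most 1/2 and 1 - w_i <
   1/2 - eps/2. *)
apply/orP; have [q_small|q_large] := leP (x 0 ord0) 2^-1; [left|right].
  apply: Pr_homothety => //; first exact: Pr_quota_small Px xi2 q_small.
  by apply: homothety_ratio_le K0 Keps _; lra.
apply: Pr_homothety => //; first exact: Pr_quota_large Px xi2 (ltW q_large).
by apply: homothety_ratio_le K0 Keps _; lra.
Qed.

Lemma archi_scale (R : archiRealFieldType) (eps : R) :
  0 < eps -> exists2 K, (0 < K)%N & 4 <= K%:R * eps.
Proof.
move=> eps0; exists (Num.bound (4 / eps)).+1 => //; rewrite -ler_pdivrMr//.
apply: le_trans (ltW (archi_boundP _)) _; first by rewrite divr_ge0// ltW.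
by rewrite ler_nat.
Qed.

Theorem theorem8 (R : archiRealFieldType) :
  (forall (n : nat) (v : game n), simple_game v ->
     forall i : 'I_n, PGI R v i = 1 \/ PGI R v i <= 2^-1) /\
  (forall (n : nat) (v : game n), simple_game v ->
     forall i : 'I_n, DP R v i = 1 \/ DP R v i <= 2^-1) /\
  (forall (n : nat) (v : game n), simple_game v ->
     forall x : 'rV[R]_n, is_nucleolus v x ->
     forall i : 'I_n, x 0 i = 1 \/ x 0 i <= 2^-1) /\
  (forall (n : nat) (v : game n), weighted_game R v ->
     forall p : 'rV[R]_n, is_MSRI v p ->
     forall i : 'I_n, p 0 i = 1 \/ p 0 i <= 2^-1) /\
  (forall eps : R, 0 < eps -> exists N : nat, forall n : nat, (N <= n)%N ->
     forall v : game n, weighted_game R v ->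
     forall c : 'rV[R]_n, is_AWI v c ->
     forall i : 'I_n, c 0 i = 1 \/ c 0 i <= 2^-1 + eps) /\
  (forall eps : R, 0 < eps -> exists N : nat, forall n : nat, (N <= n)%N ->
     forall v : game n, weighted_game R v ->
     forall c : 'rV[R]_n.+1, is_ARI v c ->
     forall i : 'I_n, c 0 (lift ord0 i) = 1 \/ c 0 (lift ord0 i) <= 2^-1 + eps).
Proof.
split; first by move=> n v sv i; exact: PGI_eq1_or_le_half.
split; first by move=> n v sv i; exact: DP_eq1_or_le_half.
split; first by move=> n v sv x nuc i; exact: nucleolus_eq1_or_le_half sv nuc i.
split; first by move=> n v [sv _] p msri i; exact: MSRI_eq1_or_le_half sv msri.
split=> eps /archi_scale[K K0 Keps]; exists (2 * K ^ 2).+1 => n Kn v wv c cc i; right.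
  exact: AWI_le wv cc K0 Keps Kn.
exact: ARI_le wv cc K0 Keps Kn.
Qed.
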